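(* Let $(X,\mathcal{R})$ be a $d$-class $P$-polynomial association scheme with path distance $\partial$, and let $C$ be a non-empty subset of $X$ with inner distribution $(a_0,\ldots,a_d)$, dual degree $s^*$ and outer distribution matrix $B$. Assume there exists $w\in\{0,1,\ldots,d-s^*\}$ such that $a_w>0$ and such that for every $i\in\{0,1,\ldots,s^*\}$ and every $x\in X$ with $\partial(x,C)=i$ we have $B_{x,j}=0$ whenever $w+i+1\le j\le w+s^*$. Then $C$ is completely regular.
   Context: $(X,\mathcal{R})$ is a symmetric association scheme with adjacency matrices $A_0=I,\ldots,A_d$ and primitive idempotents $E_0=\frac1{|X|}J,E_1,\ldots,E_d$, $P$-polynomial with respect to $A_0,\ldots,A_d$; equivalently $(X,R_1)$ is a distance-regular graph of diameter $d$ with path distance $\partial$, and $(x,y)\in R_i$ iff $\partial(x,y)=i$. For $C\subseteq X$ with characteristic vector $\chi$: $a_i=\frac1{|C|}\chi^TA_i\chi$; the dual degree is $s^*=|\{j:1\le j\le d,\ \chi^TE_j\chi\neq0\}|$; the outer distribution matrix $B$ is the $|X|\times(d+1)$ matrix with $B_{x,i}=e_x^TA_i\chi$, the number of $y\in C$ with $\partial(x,y)=i$ ($e_x$ the characteristic vector of $\{x\}$). $\partial(x,C)=\min\{\partial(x,y):y\in C\}$. $C$ is completely regular if for each $x\in X$ and $i$, $B_{x,i}$ depends only on $\partial(x,C)$ and $i$. *)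

(* Defs.v *)
From mathcomp Require Import all_boot all_order all_algebra.

Set Implicit Arguments.
Unset Strict Implicit.
Unset Printing Implicit Defensive.

Import Order.TTheory GRing.Theory Num.Theory.
Local Open Scope ring_scope.

(* Symmetric association schemes with d classes on X.  The relations are
   nonempty, so that d is really the number of classes and X is nonempty. *)
Record assoc_scheme (X : finType) (d : nat) := AssocScheme {
  srel :> 'I_d.+1 -> rel X;
  srel_nonempty : forall i, exists x y, srel i x y;
  srel_partition : forall x y, exists! i, srel i x y;
  srel_diag : forall x y, srel ord0 x y = (x == y);
  srel_sym : forall i, symmetric (srel i);
  srel_intersection : forall i j k, exists p : nat, forall x y,
    srel k x y -> #|[set z | srel i x z && srel j z y]| = p
}.

(* The rows and columns of matrices are indexed by X through enum_val and
   enum_rank. *)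
Definition adj (R : nzRingType) (X : finType) (d : nat)
    (S : assoc_scheme X d) (i : 'I_d.+1) : 'M[R]_#|X| :=
  \matrix_(u, v) (S i (enum_val u) (enum_val v))%:R.

Definition char_vec (R : nzRingType) (X : finType) (C : {set X}) :
    'cV[R]_#|X| :=
  \col_u (enum_val u \in C)%:R.

Definition bose_mesner (R : fieldType) (X : finType) (d : nat)
    (S : assoc_scheme X d) : {vspace 'M[R]_#|X|} :=
  <<codom (adj R S)>>%VS.

(* The Bose-Mesner algebra of a symmetric scheme is commutative, so the
   one-sided condition M *m F = F says that F lies below M. *)
Definition primitive_idempotent (R : fieldType) (X : finType) (d : nat)
    (S : assoc_scheme X d) (M : 'M[R]_#|X|) : Prop :=
  [/\ M \in bose_mesner R S, M *m M = M, M != 0 &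
      forall F, F \in bose_mesner R S -> F *m F = F -> M *m F = F ->
        F = 0 \/ F = M].

Definition primitive_idempotents (R : fieldType) (X : finType) (d : nat)
    (S : assoc_scheme X d) (E : 'I_d.+1 -> 'M[R]_#|X|) : Prop :=
  [/\ E ord0 = (#|X|%:R)^-1 *: const_mx 1, injective E &
      forall M, primitive_idempotent S M <-> exists j, M = E j].

(* horner_mx is not available here because the dimension #|X| is not
   syntactically a successor. *)
Definition poly_mx (R : nzRingType) (n : nat) (p : {poly R}) (A : 'M[R]_n) :
    'M[R]_n :=
  \sum_(k < size p) p`_k *: A ^+ k.

(* The index of R_1; for d = 0 there is no R_1 and inord gives ord0, in which
   case P-polynomiality only says that A_0 = 1. *)
Definition idx1 (d : nat) : 'I_d.+1 := inord 1.

(* A_i is a polynomial of degree i in A_1, for the given order of the A_i. *)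
Definition P_polynomial (R : fieldType) (X : finType) (d : nat)
    (S : assoc_scheme X d) : Prop :=
  forall i : 'I_d.+1, exists v : {poly R},
    size v = i.+1 /\ adj R S i = poly_mx v (adj R S (idx1 d)).

(* Least number of edges of a path from x to y in the graph e, and #|X| when
   there is none; #|X| is never the length of a shortest path. *)
Definition path_dist (X : finType) (e : rel X) (x y : X) : nat :=
  find (fun k => [exists p : k.-tuple X, path e x p && (last x p == y)])
       (iota 0 #|X|).

Definition sdist (X : finType) (d : nat) (S : assoc_scheme X d) (x y : X) :
    nat :=
  path_dist (S (idx1 d)) x y.

(* The neutral element #|X| bounds every distance, so this is the minimum over
   C as soon as C is nonempty. *)
Definition sdist_set (X : finType) (d : nat) (S : assoc_scheme X d) (x : X)
    (C : {set X}) : nat :=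
  \big[minn/#|X|]_(y in C) sdist S x y.

Definition bilin (R : nzRingType) (n : nat) (u : 'cV[R]_n) (A : 'M[R]_n)
    (v : 'cV[R]_n) : R :=
  (u^T *m A *m v) 0 0.

Definition inner_distr (R : fieldType) (X : finType) (d : nat)
    (S : assoc_scheme X d) (C : {set X}) (i : 'I_d.+1) : R :=
  (#|C|%:R)^-1 * bilin (char_vec R C) (adj R S i) (char_vec R C).

Definition dual_degree (R : fieldType) (X : finType) (d : nat)
    (E : 'I_d.+1 -> 'M[R]_#|X|) (C : {set X}) : nat :=
  #|[set j : 'I_d.+1 |
      (j != ord0) && (bilin (char_vec R C) (E j) (char_vec R C) != 0)]|.

Definition outer_distr (R : fieldType) (X : finType) (d : nat)
    (S : assoc_scheme X d) (C : {set X}) : 'M[R]_(#|X|, d.+1) :=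
  \matrix_(u, i)
    bilin (char_vec R [set enum_val u]) (adj R S i) (char_vec R C).

Definition completely_regular (R : fieldType) (X : finType) (d : nat)
    (S : assoc_scheme X d) (C : {set X}) : Prop :=
  forall (x y : X) (i : 'I_d.+1), sdist_set S x C = sdist_set S y C ->
    outer_distr R S C (enum_rank x) i = outer_distr R S C (enum_rank y) i.

(* Main.v *)
Require Import Defs.
From mathcomp Require Import all_boot all_order all_algebra.

(** Let W be the column space of the outer distribution matrix B, s the dual
    degree, and C_i the set of points at distance i from C.  The vectors
    E_j chi span W, so dim W <= s + 1; and W contains the all-one vector.
    Extending a geodesic between two points of C at distance w yields, for
    each i <= s, a point x_i of C_i at distance w + i from some point of C.
    At x_0, .., x_s the columns 0, .., s of B and the columns w, .., w + s of B
    are triangular, in opposite senses, so both families are bases of W.  The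
    first i + 1 columns of one family and the last s - i + 1 of the other span
    subspaces that meet, for reasons of dimension, in a nonzero f_i, which is
    supported on C_i.  Then f_0, .., f_s is a basis of W; since the all-one
    vector is a combination of them, each f_i is constant on C_i, and hence so
    is every column of B. *)

Import Order.TTheory GRing.Theory Num.Theory.
Local Open Scope ring_scope.

Lemma mem_span_codom {K : fieldType} {V : vectType K} {I : finType}
    (f : I -> V) (v : V) :
  v \in <<codom f>>%VS <-> exists c : I -> K, v = \sum_i c i *: f i.
Proof.
split=> [|[c ->]].
  rewrite span_def big_image /= => /memv_sumP[vs vsP ->].
  have [c cP] := fin_all_exists (fun i => vlineP _ _ (vsP i isT)).
  by exists c; apply: eq_bigr => i _; rewrite cP.
by apply: memv_suml => i _; rewrite memvZ // memv_span // codom_f.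
Qed.

Lemma trig_unitmx {K : fieldType} {n : nat} (A : 'M[K]_n) :
  is_trig_mx A -> (forall i, A i i != 0) -> A \in unitmx.
Proof.
move=> trA nzA; rewrite unitmxE det_trig // unitfE.
by apply/prodf_neq0 => i _; exact: nzA.
Qed.

Lemma mul_trig_zero_prefix {K : fieldType} {n : nat} (T : 'M[K]_n)
    (z : 'cV[K]_n) (j : nat) :
    is_trig_mx T -> (forall i, T i i != 0) ->
    (forall k : 'I_n, (k < j)%N -> (T *m z) k 0 = 0) ->
  forall k : 'I_n, (k < j)%N -> z k 0 = 0.
Proof.
move=> /is_trig_mxP trT nzT Tz0 k.
have [m] := ubnP (val k); elim: m => // m IHm in k * => lekm ltkj.
have := Tz0 k ltkj; rewrite mxE (bigD1 k) //= big1 => [|i neik].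
  by rewrite addr0 => /eqP; rewrite mulf_eq0 (negPf (nzT k)) => /eqP.
have [ltik|ltki|/val_inj eik] := ltngtP (val i) (val k).
- by rewrite (IHm i (leq_trans ltik lekm) (ltn_trans ltik ltkj)) mulr0.
- by rewrite trT ?mul0r.
- by rewrite eik eqxx in neik.
Qed.

Lemma mul_cotrig_zero_suffix {K : fieldType} {n : nat} (T : 'M[K]_n)
    (z : 'cV[K]_n) (j : nat) :
    is_trig_mx T^T -> (forall i, T i i != 0) ->
    (forall k : 'I_n, (j < k)%N -> (T *m z) k 0 = 0) ->
  forall k : 'I_n, (j < k)%N -> z k 0 = 0.
Proof.
move=> /is_trig_mxP trT nzT Tz0 k.
have [m] := ubnP (n - val k); elim: m => // m IHm in k * => lekm ltkj.
have := Tz0 k ltkj; rewrite mxE (bigD1 k) //= big1 => [|i neik].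
  by rewrite addr0 => /eqP; rewrite mulf_eq0 (negPf (nzT k)) => /eqP.
have [ltik|ltki|/val_inj eik] := ltngtP (val i) (val k).
- by have := trT i k ltik; rewrite mxE => ->; rewrite mul0r.
- rewrite (IHm i) ?mulr0 ?(ltn_trans ltkj) //.
  by apply: (leq_trans (ltn_sub2l (ltn_ord k) ltki)); rewrite -ltnS.
- by rewrite eik eqxx in neik.
Qed.

Lemma eqmx_colsub_unit {K : fieldType} {m n N : nat} (W : 'M[K]_(m, N))
    (P : 'M[K]_(n, N)) (x : 'I_n -> 'I_N) :
  (\rank W <= n)%N -> (P <= W)%MS -> colsub x P \in unitmx -> (P :=: W)%MS.
Proof.
move=> rkW PW uPx; apply/eqmxP; rewrite -(geq_leqif (mxrank_leqif_eq PW)).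
apply: leq_trans rkW _; rewrite -[X in (X <= _)%N](mxrank_unit uPx).
have -> : colsub x P = P *m colsub x 1%:M.
  apply/matrixP => i k; rewrite -[in LHS](mulmx1 P) !mxE.
  by apply: eq_bigr => l _; rewrite !mxE.
exact: mxrankM_maxl.
Qed.

(* Evaluation at the points x_0, .., x_(n-1) is an isomorphism from the row
   space of W to K^n.  In the coordinates it gives, the column y of W is
   supported on {j, .., n-1} because of P and on {0, .., j} because of Q. *)
Lemma two_flags_eval {K : fieldType} {m n N : nat} (W : 'M[K]_(m, N))
    (P Q : 'M[K]_(n, N)) (x : 'I_n -> 'I_N) :
    (\rank W <= n)%N -> (P <= W)%MS -> (Q <= W)%MS ->
    ((const_mx 1 : 'rV[K]_N) <= W)%MS ->
    is_trig_mx (colsub x P) -> (forall i, P i (x i) != 0) ->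
    is_trig_mx (colsub x Q)^T -> (forall i, Q i (x i) != 0) ->
  forall (y : 'I_N) (j : 'I_n),
    (forall i : 'I_n, (i < j)%N -> P i y = 0) ->
    (forall i : 'I_n, (j < i)%N -> Q i y = 0) ->
  forall g : 'rV[K]_N, (g <= W)%MS -> g 0 y = g 0 (x j).
Proof.
move=> rkW PW QW oneW trPx nzP trQx nzQ y j Py Qy.
have nzPx i : colsub x P i i != 0 by rewrite mxE.
have nzQx i : colsub x Q i i != 0 by rewrite mxE.
have colsubM r (A : 'M_(r, n)) (B : 'M_(n, N)) :
    colsub x (A *m B) = A *m colsub x B.
  by apply/matrixP => a b; rewrite !mxE; apply: eq_bigr => k _; rewrite mxE.
have uP : colsub x P \in unitmx by apply: trig_unitmx.
have eqPW := eqmx_colsub_unit W P x rkW PW uP.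
pose F := invmx (colsub x P) *m P.
have Fx : colsub x F = 1%:M by rewrite colsubM mulVmx.
have expand r (G : 'M_(r, N)) : (G <= W)%MS -> G = colsub x G *m F.
  rewrite -eqPW => /submxP[D ->].
  by rewrite colsubM -mulmxA /F mulKVmx.
clearbody F.
have F0 k : k != j -> F k y = 0.
  have colE (G : 'M_(n, N)) k' : (G <= W)%MS ->
      (colsub x G *m col y F) k' 0 = G k' y.
    move=> GW; rewrite {2}(expand _ _ GW) !mxE.
    by apply: eq_bigr => l _; rewrite !mxE.
  have colF k' : F k' y = col y F k' 0 by rewrite mxE.
  rewrite neq_ltn colF => /orP[ltkj|ltjk].
    apply: (mul_trig_zero_prefix _ _ j trPx nzPx _ k ltkj) => k' ltk'.
    by rewrite colE ?Py.
  apply: (mul_cotrig_zero_suffix _ _ j trQx nzQx _ k ltjk) => k' ltk'.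
  by rewrite colE ?Qy.
have evalE (g : 'rV_N) : (g <= W)%MS -> g 0 y = g 0 (x j) * F j y.
  move=> gW; rewrite {1}(expand _ _ gW) mxE (bigD1 j) //= big1 ?addr0.
    by rewrite mxE.
  by move=> k nekj; rewrite F0 ?mulr0.
have := evalE _ oneW; rewrite !mxE mul1r => F1 g /evalE->.
by rewrite -F1 mulr1.
Qed.

Definition walk {X : finType} (e : rel X) (k : nat) (x y : X) : bool :=
  [exists p : k.-tuple X, path e x p && (last x p == y)].

Lemma walkP {X : finType} (e : rel X) (k : nat) (x y : X) :
  reflect (exists p, [/\ size p = k, path e x p & last x p = y])
          (walk e k x y).
Proof.
apply: (iffP existsP) => [[p /andP[xp /eqP lp]]|[p [szp xp lp]]].
  by exists p; rewrite size_tuple.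
by exists (tcast szp (in_tuple p)); rewrite val_tcast xp lp eqxx.
Qed.

Lemma walk_cat {X : finType} (e : rel X) (m n : nat) (x z y : X) :
  walk e m x z -> walk e n z y -> walk e (m + n) x y.
Proof.
move=> /walkP[p [<- xp <-]] /walkP[q [<- pq <-]].
by apply/walkP; exists (p ++ q); rewrite size_cat cat_path xp last_cat.
Qed.

Lemma walk_split {X : finType} (e : rel X) (m n : nat) (x y : X) :
  walk e (m + n) x y -> exists2 z, walk e m x z & walk e n z y.
Proof.
move=> /walkP[p [szp]]; rewrite -[p](cat_take_drop m) cat_path last_cat.
move=> /andP[xp1 xp2] lp; exists (last x (take m p)); apply/walkP.
  by exists (take m p); rewrite size_takel // szp leq_addr.
by exists (drop m p); rewrite size_drop szp addKn.
Qed.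

Lemma path_dist_eq {X : finType} (e : rel X) (k : nat) (x y : X) :
    walk e k x y -> (forall l, (l < k)%N -> ~~ walk e l x y) ->
  path_dist e x y = k.
Proof.
move=> wk mink; have ltkX : (k < #|X|)%N.
  have /walkP[p [szp xp lp]] := wk.
  case/shortenP: xp lp => q xq uq _ lq.
  apply: (@leq_trans (size (x :: q))); last first.
    by rewrite -(card_uniqP uq) max_card.
  rewrite /= ltnS leqNgt; apply/negP => /mink/negP; apply.
  by apply/walkP; exists q.
rewrite /path_dist -(subnKC ltkX) addSnnS iotaD find_cat /= add0n.
have -> : has (fun l => walk e l x y) (iota 0 k) = false.
  by apply/hasP => -[l]; rewrite mem_iota /= add0n => /mink/negP.
by rewrite size_iota -/(walk e k x y) wk addn0.
Qed.

Lemma srel_inj {X : finType} {d : nat} (S : assoc_scheme X d) i j x y :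
  S i x y -> S j x y -> i = j.
Proof.
move=> Si Sj; have [k [_ uk]] := srel_partition S x y.
by rewrite -(uk i Si) (uk j Sj).
Qed.

Lemma sum_srel {R : nzRingType} {X : finType} {d : nat}
    (S : assoc_scheme X d) (c : 'I_d.+1 -> R) k x y :
  S k x y -> \sum_i c i * (S i x y)%:R = c k.
Proof.
move=> Sk; rewrite (bigD1 k) //= Sk mulr1 big1 ?addr0 // => i neik.
case Si: (S i x y); last by rewrite mulr0.
by rewrite (srel_inj _ _ _ _ _ Si Sk) eqxx in neik.
Qed.

Lemma adj_pow_ge0 {R : realDomainType} {X : finType} {d : nat}
    (S : assoc_scheme X d) i k u v : 0 <= (adj R S i ^+ k) u v.
Proof.
elim: k u v => [|k IHk] u v; first by rewrite expr0 mxE ler0n.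
rewrite exprS mxE sumr_ge0 // => z _; rewrite mulr_ge0 //.
by rewrite mxE ler0n.
Qed.

Lemma adj_pow_neq0 {R : realDomainType} {X : finType} {d : nat}
    (S : assoc_scheme X d) i k u v :
  ((adj R S i ^+ k) u v != 0) = walk (S i) k (enum_val u) (enum_val v).
Proof.
elim: k u v => [|k IHk] u v.
  rewrite expr0 mxE pnatr_eq0 eqb0 negbK; apply/eqP/walkP => [->|].
    by exists [::].
  by case=> p [/size0nil-> _ /enum_val_inj].
rewrite exprS mxE psumr_neq0 => [|z _]; last first.
  by rewrite mulr_ge0 ?adj_pow_ge0 // mxE ler0n.
apply/hasP/walkP => [[z _ /=]|[[|a p] []]].
  rewrite lt0r mulf_eq0 negb_or => /andP[/andP[]]; rewrite IHk mxE.
  case uz: (S i _ _); last by rewrite eqxx.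
  move=> _ /walkP[p [szp zp lp]] _.
  by exists (enum_val z :: p); rewrite /= szp uz.
  by [].
move=> /= [szp] /andP[ua ap] lp; exists (enum_rank a).
  by rewrite mem_index_enum.
rewrite /= mxE enum_rankK ua mul1r lt0r IHk adj_pow_ge0 andbT enum_rankK.
by apply/walkP; exists p.
Qed.

(* By induction on k, since A_k is a polynomial in A_1 of degree exactly k. *)
Lemma adj_pow_eq0 {R : rcfType} {X : finType} {d : nat}
    (S : assoc_scheme X d) (hP : P_polynomial R S) (i : 'I_d.+1) k u v :
    S i (enum_val u) (enum_val v) -> (k < i)%N ->
  (adj R S (idx1 d) ^+ k) u v = 0.
Proof.
move=> Si; have [m] := ubnP k; elim: m => // m IHm in k * => lekm ltki.
have [q [szq Eq]] := hP (Ordinal (ltn_trans ltki (ltn_ord i))).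
have /matrixP/(_ u v) := Eq.
rewrite /poly_mx szq big_ord_recr /= !mxE summxE big1 => [|l _].
  case Sk: (S _ _ _).
    have /(congr1 val)/= ek := srel_inj _ _ _ _ _ Sk Si.
    by have := ltki; rewrite {1}ek ltnn.
  rewrite add0r => /esym/eqP; rewrite mulf_eq0.
  have -> : q`_k = lead_coef q by rewrite lead_coefE szq.
  by rewrite lead_coef_eq0 -size_poly_eq0 szq => /eqP.
rewrite !mxE IHm ?mulr0 //; first exact: leq_trans (ltn_ord l) _.
exact: ltn_trans (ltn_ord l) ltki.
Qed.

Lemma walk_srel_ge {R : rcfType} {X : finType} {d : nat}
    (S : assoc_scheme X d) (hP : P_polynomial R S) (i : 'I_d.+1) k x y :
  S i x y -> walk (S (idx1 d)) k x y -> (i <= k)%N.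
Proof.
move=> Si; rewrite leqNgt -[x]enum_rankK -[y]enum_rankK => wk.
apply/negP => ltki; move: wk; rewrite -(@adj_pow_neq0 R) => /eqP; apply.
by apply: adj_pow_eq0 ltki; rewrite // !enum_rankK.
Qed.

Lemma srel_walk {R : rcfType} {X : finType} {d : nat}
    (S : assoc_scheme X d) (hP : P_polynomial R S) (i : 'I_d.+1) x y :
  S i x y -> walk (S (idx1 d)) i x y.
Proof.
move=> Si; have [q [szq Eq]] := hP i.
apply: contraT => nwi.
have /matrixP/(_ (enum_rank x) (enum_rank y)) := Eq.
rewrite /poly_mx szq summxE mxE !enum_rankK Si big1 => [/eqP|l _].
  by rewrite oner_eq0.
rewrite mxE; apply/eqP; rewrite mulf_eq0; apply/orP; right.
apply: contraT; rewrite adj_pow_neq0 !enum_rankK => wl.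
have := walk_srel_ge S hP i l x y Si wl; rewrite leq_eqVlt.
case/orP => [/eqP eil|]; first by rewrite eil wl in nwi.
by rewrite ltnNge -ltnS ltn_ord.
Qed.

Lemma sdist_srel {R : rcfType} {X : finType} {d : nat}
    (S : assoc_scheme X d) (hP : P_polynomial R S) (i : 'I_d.+1) x y :
  S i x y -> sdist S x y = i.
Proof.
move=> Si; apply: path_dist_eq => [|l]; first exact: srel_walk Si.
by rewrite ltnNge; apply: contra => /(walk_srel_ge S hP _ _ _ _ Si).
Qed.

Lemma sdist_set_le {R : rcfType} {X : finType} {d : nat}
    (S : assoc_scheme X d) (hP : P_polynomial R S) (C : {set X})
    (i : 'I_d.+1) x y :
  y \in C -> S i x y -> (sdist_set S x C <= i)%N.
Proof.
move=> Cy Si; rewrite -(sdist_srel S hP _ _ _ Si) -leEnat.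
exact: (bigmin_le_cond #|X| (sdist S x) Cy).
Qed.

(* A geodesic between points at distance w + i passes through a point at
   distances w and i, and intersection numbers do not depend on the pair. *)
Lemma srel_extend {R : rcfType} {X : finType} {d : nat}
    (S : assoc_scheme X d) (hP : P_polynomial R S) (w i k : 'I_d.+1) x y :
    k = (w + i)%N :> nat -> S w x y ->
  exists2 z, S k x z & S i y z.
Proof.
move=> ek Sw; have [a [b Sk]] := srel_nonempty S k.
have := srel_walk S hP _ _ _ Sk; rewrite ek => /walk_split[m wam wmb].
have [l [Sl _]] := srel_partition S a m.
have [r [Sr _]] := srel_partition S m b.
have lelw := walk_srel_ge S hP _ _ _ _ Sl wam.
have leri := walk_srel_ge S hP _ _ _ _ Sr wmb.
have := walk_srel_ge S hP _ _ _ _ Sk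
  (walk_cat _ _ _ _ _ _ (srel_walk S hP _ _ _ Sl) (srel_walk S hP _ _ _ Sr)).
rewrite ek => lelr.
have el : l = w.
  apply/val_inj/eqP; rewrite eqn_leq lelw -(leq_add2r i) (leq_trans lelr) //.
  by rewrite leq_add2l.
have er : r = i.
  apply/val_inj/eqP; rewrite eqn_leq leri -(leq_add2l w) (leq_trans lelr) //.
  by rewrite leq_add2r.
rewrite {}el {l lelw lelr} in Sl *; rewrite {}er {r leri} in Sr *.
have [p pE] := srel_intersection S k i w.
have : [set z | S k x z && S i z y] != set0.
  rewrite -card_gt0 (pE _ _ Sw) -(pE _ _ Sl); apply/card_gt0P; exists b.
  by rewrite inE Sk srel_sym.
by case/set0Pn => z; rewrite inE => /andP[Skz]; rewrite srel_sym; exists z.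
Qed.

Lemma bose_mesnerP {R : fieldType} {X : finType} {d : nat}
    (S : assoc_scheme X d) (M : 'M[R]_#|X|) :
  M \in bose_mesner R S <-> exists c : 'I_d.+1 -> R,
    forall k u v, S k (enum_val u) (enum_val v) -> M u v = c k.
Proof.
split=> [/mem_span_codom|] [c cP]; [|apply/mem_span_codom]; exists c.
  move=> k u v Sk; rewrite cP summxE -(sum_srel S c _ _ _ Sk).
  by apply: eq_bigr => i _; rewrite !mxE.
apply/matrixP => u v.
have [k [Sk _]] := srel_partition S (enum_val u) (enum_val v).
rewrite (cP _ _ _ Sk) summxE -(sum_srel S c _ _ _ Sk).
by apply: eq_bigr => i _; rewrite !mxE.
Qed.

Lemma bose_mesner_sym {R : fieldType} {X : finType} {d : nat}
    (S : assoc_scheme X d) (M : 'M[R]_#|X|) :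
  M \in bose_mesner R S -> M^T = M.
Proof.
move=> /bose_mesnerP[c cP]; apply/matrixP => u v; rewrite mxE.
have [k [Sk _]] := srel_partition S (enum_val u) (enum_val v).
by rewrite (cP _ _ _ Sk); apply: cP; rewrite srel_sym.
Qed.

Lemma bose_mesnerM {R : fieldType} {X : finType} {d : nat}
    (S : assoc_scheme X d) (M N : 'M[R]_#|X|) :
    M \in bose_mesner R S -> N \in bose_mesner R S ->
  M *m N \in bose_mesner R S.
Proof.
have adjM i j : adj R S i *m adj R S j \in bose_mesner R S.
  have [p pE] := fin_all_exists (srel_intersection S i j).
  apply/bose_mesnerP; exists (fun k => (p k)%:R) => k u v Sk.
  rewrite mxE -(pE _ _ _ Sk) -sum1_card natr_sum.
  rewrite [RHS](reindex_onto enum_val enum_rank) => [|z _]; last first.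
    exact: enum_rankK.
  rewrite [RHS]big_mkcond; apply: eq_bigr => z _.
  by rewrite !mxE inE enum_valK eqxx andbT; do 2!case: (S _ _ _);
     rewrite ?mulr1 ?mulr0 ?mul0r.
move=> /mem_span_codom[c ->] /mem_span_codom[c' ->].
rewrite mulmx_suml memv_suml // => i _; rewrite mulmx_sumr memv_suml // => j _.
by rewrite -scalemxAl -scalemxAr !memvZ.
Qed.

Lemma bose_mesnerC {R : fieldType} {X : finType} {d : nat}
    (S : assoc_scheme X d) (M N : 'M[R]_#|X|) :
    M \in bose_mesner R S -> N \in bose_mesner R S ->
  M *m N = N *m M.
Proof.
move=> BM BN; rewrite -(bose_mesner_sym S _ (bose_mesnerM S _ _ BM BN)).
by rewrite trmx_mul (bose_mesner_sym S _ BM) (bose_mesner_sym S _ BN).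
Qed.

Lemma primitive_idempotents_orth {R : fieldType} {X : finType} {d : nat}
    (S : assoc_scheme X d) (E : 'I_d.+1 -> 'M[R]_#|X|) :
    primitive_idempotents S E ->
  forall i j, i != j -> E i *m E j = 0.
Proof.
move=> [_ injE Eprim] i j neij.
have [Bi Ii _ mini] := (Eprim (E i)).2 (ex_intro _ i erefl).
have [Bj Ij _ minj] := (Eprim (E j)).2 (ex_intro _ j erefl).
have BF := bose_mesnerM S _ _ Bi Bj; have cF := bose_mesnerC S _ _ Bi Bj.
set F := E i *m E j in BF cF *.
have iF : E i *m F = F by rewrite mulmxA Ii.
have jF : E j *m F = F by rewrite cF mulmxA Ij.
have FF : F *m F = F by rewrite -{1}[F]/(E i *m E j) -mulmxA jF.
have [//|FEi] := mini F BF FF iF; have [//|FEj] := minj F BF FF jF.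
by case/eqP: neij; apply: injE; rewrite -FEi.
Qed.

(* Orthogonal nonzero idempotents are independent, and there are as many of
   them as there are adjacency matrices. *)
Lemma bose_mesner_primitive {R : fieldType} {X : finType} {d : nat}
    (S : assoc_scheme X d) (E : 'I_d.+1 -> 'M[R]_#|X|) :
  primitive_idempotents S E -> bose_mesner R S = <<codom E>>%VS.
Proof.
move=> hE; have [_ _ Eprim] := hE.
have primE j := (Eprim (E j)).2 (ex_intro _ j erefl).
apply/esym/eqP; rewrite eqEdim; apply/andP; split.
  by apply/span_subvP => _ /codomP[j ->]; have [] := primE j.
apply: (leq_trans (dim_span _)); rewrite size_codom card_ord.
have -> : codom E = [tuple E j | j < d.+1] by [].
suff /eqP-> : free [tuple E j | j < d.+1] by rewrite size_tuple.
apply/freeP => c /(congr1 (mulmx _)) cE0 j.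
have := cE0 _ (E j); rewrite mulmx0 mulmx_sumr (bigD1 j) // big1 => [|i neij].
  have [_ Ij nzj _] := primE j.
  rewrite -tnth_nth tnth_mktuple -scalemxAr Ij /= addr0 => /eqP.
  by rewrite scaler_eq0 (negPf nzj) orbF => /eqP.
rewrite -tnth_nth tnth_mktuple -scalemxAr.
by rewrite (primitive_idempotents_orth S E) ?scaler0 // eq_sym.
Qed.

Lemma outer_distrE {R : fieldType} {X : finType} {d : nat}
    (S : assoc_scheme X d) (C : {set X}) u i :
  outer_distr R S C u i = (adj R S i *m char_vec R C) u 0.
Proof.
rewrite mxE /bilin -mulmxA mxE (bigD1 u) //= big1 => [|v nevu].
  by rewrite !mxE inE eqxx mul1r addr0.
by rewrite !mxE inE (inj_eq enum_val_inj) (negPf nevu) mul0r.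
Qed.

Lemma outer_distr_neq0 {R : numFieldType} {X : finType} {d : nat}
    (S : assoc_scheme X d) (C : {set X}) u i :
  (outer_distr R S C u i != 0) = [exists y in C, S i (enum_val u) y].
Proof.
rewrite outer_distrE mxE psumr_neq0 => [|v _]; last first.
  by rewrite !mxE mulr_ge0 ?ler0n.
apply/hasP/exists_inP => [[v _ /=]|[y Cy Si]].
  rewrite !mxE -natrM mulnb ltr0n lt0b => /andP[Si Cv].
  by exists (enum_val v).
exists (enum_rank y); first by rewrite mem_index_enum.
by rewrite /= !mxE enum_rankK Cy Si mulr1 ltr01.
Qed.

Lemma bilin_idem_eq0 {R : realDomainType} {n : nat} (E : 'M[R]_n)
    (v : 'cV[R]_n) :
  E^T = E -> E *m E = E -> bilin v E v = 0 -> E *m v = 0.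
Proof.
move=> Esym Eidem; have -> : bilin v E v = ((E *m v)^T *m (E *m v)) 0 0.
  by rewrite trmx_mul Esym -mulmxA (mulmxA E) Eidem mulmxA.
rewrite mxE => /eqP; rewrite psumr_eq0 => [/allP z0|u _]; last first.
  by rewrite mxE -expr2 sqr_ge0.
apply/matrixP => u j; rewrite ord1 [RHS]mxE.
have := z0 u (mem_index_enum u).
by rewrite /= mxE -expr2 sqrf_eq0 => /eqP.
Qed.

Lemma rank_outer_distr {R : rcfType} {X : finType} {d : nat}
    (S : assoc_scheme X d) (E : 'I_d.+1 -> 'M[R]_#|X|) (C : {set X}) :
    primitive_idempotents S E ->
  (\rank (outer_distr R S C)^T <= (dual_degree E C).+1)%N.
Proof.
move=> hE; have [_ _ Eprim] := hE; set chi := char_vec R C.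
pose D := [set j | (j == ord0) || (bilin chi (E j) chi != 0)].
have E0 j : j \notin D -> E j *m chi = 0.
  rewrite inE negb_or negbK => /andP[_ /eqP].
  have [BEj IEj _ _] := (Eprim (E j)).2 (ex_intro _ j erefl).
  by apply: bilin_idem_eq0 => //; exact: bose_mesner_sym BEj.
have cardD : #|D| = (dual_degree E C).+1.
  rewrite (cardsD1 ord0) inE eqxx /= add1n; congr _.+1.
  by apply: eq_card => j; rewrite !inE; case: (j == ord0).
have sub : ((outer_distr R S C)^T <= \sum_(j in D) <<(E j *m chi)^T>>)%MS.
  apply/row_subP => i.
  have -> : row i (outer_distr R S C)^T = (adj R S i *m chi)^T.
    by apply/matrixP => a u; rewrite ord1 2!mxE outer_distrE [RHS]mxE.
  have : adj R S i \in bose_mesner R S by rewrite memv_span ?codom_f.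
  rewrite (bose_mesner_primitive S E hE) => /mem_span_codom[c ->].
  rewrite mulmx_suml linear_sum summx_sub // => j _.
  rewrite -scalemxAl linearZ scalemx_sub //.
  have [jD|/E0->] := boolP (j \in D); last by rewrite linear0 sub0mx.
  by apply: (sumsmx_sup j jD); rewrite genmxE.
rewrite -cardD (leq_trans (mxrankS sub)) // -sum1_card.
apply: leq_trans (mxrank_sum_leqif _).1 _; apply: leq_sum => j _ /=.
by rewrite genmxE rank_leq_row.
Qed.

Lemma const1_sub_outer_distr {R : rcfType} {X : finType} {d : nat}
    (S : assoc_scheme X d) (C : {set X}) :
  C != set0 -> ((const_mx 1 : 'rV[R]_#|X|) <= (outer_distr R S C)^T)%MS.
Proof.
move=> nzC; apply/submxP; exists (const_mx (#|C|%:R^-1)).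
apply/matrixP => a u; rewrite mxE.
rewrite mxE (eq_bigr (fun i => #|C|%:R^-1 * outer_distr R S C u i)); last first.
  by move=> i _; rewrite mxE [in X in _ * X]mxE.
rewrite -mulr_sumr (eq_bigr _ (fun i _ => outer_distrE S C u i)).
under eq_bigr do rewrite mxE.
rewrite exchange_big /=.
rewrite (eq_bigr (fun v => (enum_val v \in C)%:R)) => [|v _].
  rewrite (reindex_onto enum_rank enum_val) /= => [|v _]; last exact: enum_valK.
  rewrite (eq_bigr (fun y => (y \in C)%:R)) => [|y _]; last first.
    by rewrite enum_rankK.
  rewrite (eq_bigl xpredT) => [|y]; last by rewrite enum_rankK eqxx.
  have -> : \sum_y (y \in C)%:R = #|C|%:R :> R.
    rewrite -sum1_card natr_sum [RHS]big_mkcond.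
    by apply: eq_bigr => y _; case: (y \in C).
  by rewrite mulVf ?mxE // pnatr_eq0 cards_eq0.
have [k [Sk _]] := srel_partition S (enum_val u) (enum_val v).
rewrite -mulr_suml -[RHS]mul1r mxE; congr (_ * _).
rewrite -[RHS](sum_srel S (fun=> 1) _ _ _ Sk).
by apply: eq_bigr => i _; rewrite mxE mul1r.
Qed.

Theorem theorem2p4 (R : rcfType) (X : finType) (d : nat)
    (S : assoc_scheme X d) (E : 'I_d.+1 -> 'M[R]_#|X|)
    (hP : P_polynomial R S)
    (hE : primitive_idempotents S E)
    (C : {set X}) (hC : C != set0)
    (hw : exists w : 'I_d.+1,
       [/\ (w <= d - dual_degree E C)%N,
           0 < inner_distr R S C w &
           forall (i : nat) (x : X) (j : 'I_d.+1),
             (i <= dual_degree E C)%N -> sdist_set S x C = i ->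
             (w + i + 1 <= j <= w + dual_degree E C)%N ->
             outer_distr R S C (enum_rank x) j = 0]) :
  completely_regular R S C.
Proof.
have [w [lew aw hB]] := hw.
have := rank_outer_distr S E C hE; set s := dual_degree E C in lew hB * => rkB.
have lesd : (s <= d)%N.
  rewrite -ltnS -[d.+1]card_ord (cardD1 ord0) inE add1n ltnS.
  by apply: subset_leq_card; apply/subsetP => j; rewrite !inE => /andP[->].
have lt_i (i : 'I_s.+1) : (i < d.+1)%N by rewrite (leq_trans (ltn_ord i)).
have lt_wi (i : 'I_s.+1) : (w + i < d.+1)%N.
  by rewrite ltnS (leq_trans (leq_add lew (ltn_ord i : i <= s)%N)) ?subnK.
pose lo i := Ordinal (lt_i i); pose hi i := Ordinal (lt_wi i).
have [c Cc [c' Cc' Sw]] : exists2 c, c \in C & exists2 c', c' \in C & S w c c'.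
  have : bilin (char_vec R C) (adj R S w) (char_vec R C) != 0.
    by apply: contraTneq aw => b0; rewrite /inner_distr b0 mulr0 ltxx.
  rewrite /bilin -mulmxA mxE psumr_neq0 => [/hasP[u _ /=]|u _].
    rewrite -outer_distrE mxE mxE.
    case Cu: (_ \in C); last by rewrite mul0r ltxx.
    rewrite mul1r lt0r outer_distr_neq0 => /andP[/exists_inP[y Cy Sy] _].
    by exists (enum_val u) => //; exists y.
  rewrite mxE mxE mxE mulr_ge0 ?ler0n // sumr_ge0 // => v _.
  by rewrite !mxE mulr_ge0 ?ler0n.
have B_lo x (j : 'I_d.+1) : (j < sdist_set S x C)%N ->
    outer_distr R S C (enum_rank x) j = 0.
  move=> ltj; apply/eqP; apply: contraTT ltj.
  rewrite outer_distr_neq0 enum_rankK -leqNgt => /exists_inP[y Cy].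
  exact: (sdist_set_le S hP).
have B_hi x (j : 'I_s.+1) : (sdist_set S x C < j)%N ->
    outer_distr R S C (enum_rank x) (hi j) = 0.
  move=> ltj; apply: (hB (sdist_set S x C)) => //.
    by rewrite -ltnS (ltn_trans ltj).
  by rewrite /= addn1 -addnS !leq_add2l ltj -ltnS ltn_ord.
have /fin_all_exists[z zP] (i : 'I_s.+1) : exists z : X,
    [/\ sdist_set S z C = i, S (lo i) z c' & S (hi i) z c].
  have [z Shi Slo] := srel_extend S hP w (lo i) (hi i) _ _ erefl Sw.
  rewrite srel_sym in Shi; rewrite srel_sym in Slo.
  exists z; split=> //; apply/eqP; rewrite eqn_leq.
  rewrite (sdist_set_le S hP _ (lo i) _ c') //= leqNgt.
  apply/negP => /B_hi/eqP; apply/negP; rewrite outer_distr_neq0 enum_rankK.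
  by apply/exists_inP; exists c.
pose P := rowsub lo (outer_distr R S C)^T.
pose Q := rowsub hi (outer_distr R S C)^T.
have oneW := @const1_sub_outer_distr R X d S C hC.
have subW (f : 'I_s.+1 -> 'I_d.+1) :
    (rowsub f (outer_distr R S C)^T <= (outer_distr R S C)^T)%MS.
  by apply/row_subP => i; rewrite row_rowsub row_sub.
have PE i x : P i (enum_rank x) = outer_distr R S C (enum_rank x) (lo i).
  by rewrite mxE mxE.
have QE i x : Q i (enum_rank x) = outer_distr R S C (enum_rank x) (hi i).
  by rewrite mxE mxE.
pose rz i := enum_rank (z i).
have trP : is_trig_mx (colsub rz P).
  apply/is_trig_mxP => i k ltik; rewrite mxE PE B_lo //.
  by have [-> _ _] := zP k.
have trQ : is_trig_mx (colsub rz Q)^T.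
  apply/is_trig_mxP => k i ltki; rewrite mxE mxE QE B_hi //.
  by have [-> _ _] := zP k.
have nzP i : P i (rz i) != 0.
  rewrite PE outer_distr_neq0 enum_rankK; apply/exists_inP; exists c' => //.
  by have [] := zP i.
have nzQ i : Q i (rz i) != 0.
  rewrite QE outer_distr_neq0 enum_rankK; apply/exists_inP; exists c => //.
  by have [] := zP i.
have radius x : (sdist_set S x C < s.+1)%N.
  rewrite ltnNge; apply/negP => ltsx.
  have uP : colsub rz P \in unitmx by apply: trig_unitmx => // i; rewrite mxE.
  have := oneW; rewrite -(eqmx_colsub_unit _ P rz rkB (subW lo) uP).
  case/submxP=> D /matrixP/(_ 0 (enum_rank x))/eqP.
  rewrite !mxE big1 ?oner_eq0 //.
  by move=> i _; rewrite PE B_lo ?mulr0 // (leq_trans (ltn_ord i)).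
have Bz x i : outer_distr R S C (enum_rank x) i =
    outer_distr R S C (rz (Ordinal (radius x))) i.
  have := two_flags_eval _ P Q rz rkB (subW lo) (subW hi) oneW trP nzP trQ nzQ
    (enum_rank x) (Ordinal (radius x)).
  have P0 (k : 'I_s.+1) : (k < Ordinal (radius x))%N -> P k (enum_rank x) = 0.
    by move=> ltk; rewrite PE B_lo.
  have Q0 (k : 'I_s.+1) : (Ordinal (radius x) < k)%N -> Q k (enum_rank x) = 0.
    by move=> ltk; rewrite QE B_hi.
  move=> /(_ P0 Q0 (row i (outer_distr R S C)^T) (row_sub _ _)).
  by rewrite 2!mxE [RHS]mxE [RHS]mxE.
move=> x y i exy; rewrite Bz [RHS]Bz; congr (outer_distr _ _ _ (rz _) _).
exact/val_inj.
Qed.
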